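(* Let $a\in\mathbf{C}$. There are no non-trivial (i.e. nonzero) homogeneous Rota--Baxter operators of weight $1$ and degree $1$ on the $\mathbf{Z}_2$-graded transposed Poisson algebra $\mathcal{W}(a,-1)=\mathbf{W}\oplus I(a,-1)$; that is, any Rota--Baxter operator $R$ of weight $1$ with $R(\mathbf{W})\subseteq I(a,-1)$ and $R(I(a,-1))\subseteq\mathbf{W}$ is zero.
   Context: All algebras are over $\mathbf{C}$. For $a\in\mathbf{C}$, the transposed Poisson algebra $\mathcal{W}(a,-1)$ is the vector space with basis $\{L_n,I_m\mid n,m\in\mathbf{Z}\}$, with commutative associative product $L_n\cdot L_m=L_{n+m}$, $L_n\cdot I_m=I_{n+m}$, $I_n\cdot I_m=0$, and Lie bracket $[L_n,L_m]=(n-m)L_{n+m}$, $[L_n,I_m]=-(m+a-n)I_{n+m}$, $[I_n,I_m]=0$. $\mathbf{W}$ is the span of the $L_n$ (degree $0$) and $I(a,-1)$ the span of the $I_m$ (degree $1$). A Rota--Baxter operator of weight $1$ on the transposed Poisson algebra is a linear map $R$ with $R(x)\star R(y)=R\bigl(R(x)\star y+x\star R(y)\bigr)+R(x\star y)$ for all $x,y$ and both products $\star\in\{\cdot,[\ ,\ ]\}$. *)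

(* Defs.v *)
From HB Require Import structures.
From mathcomp Require Import all_boot all_order all_algebra.
From mathcomp Require Import finmap ring.
From mathcomp.reals Require Import reals.
From mathcomp.real_closed Require Import complex.
From mathcomp.multinomials Require Import monalg.

Set Implicit Arguments.
Unset Strict Implicit.
Unset Printing Implicit Defensive.

Import GRing.Theory Num.Theory.
Local Open Scope ring_scope.

(* The associative product is not required to have a unit. *)
Record transposed_poisson (K : fieldType) := TransposedPoisson {
  tp_sort :> lmodType K;
  tp_dot : tp_sort -> tp_sort -> tp_sort;
  tp_bracket : tp_sort -> tp_sort -> tp_sort;
  tp_dot_linearl : forall y, linear (tp_dot^~ y);
  tp_dot_linearr : forall x, linear (tp_dot x);
  tp_dotC : commutative tp_dot;
  tp_dotA : associative tp_dot;
  tp_bracket_linearl : forall y, linear (tp_bracket^~ y);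
  tp_bracket_linearr : forall x, linear (tp_bracket x);
  tp_bracketxx : forall x, tp_bracket x x = 0;
  tp_jacobi : forall x y z,
    tp_bracket x (tp_bracket y z) + tp_bracket y (tp_bracket z x)
      + tp_bracket z (tp_bracket x y) = 0;
  tp_leibniz : forall x y z,
    tp_dot z (tp_bracket x y) *+ 2 =
      tp_bracket (tp_dot z x) y + tp_bracket x (tp_dot z y)
}.

Section RotaBaxter.
Context (K : fieldType).

Definition rota_baxter_for (A : lmodType K) (op : A -> A -> A) (lam : K)
    (f : {linear A -> A}) : Prop :=
  forall x y, op (f x) (f y) = f (op (f x) y + op x (f y)) + lam *: f (op x y).

Definition rota_baxter (A : transposed_poisson K) (lam : K)
    (f : {linear A -> A}) : Prop :=
  rota_baxter_for (@tp_dot K A) lam f /\ rota_baxter_for (@tp_bracket K A) lam f.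

(* [comp i] is the homogeneous component of degree [i]. *)
Definition z2_grading (A : transposed_poisson K) (comp : 'Z_2 -> {pred A}) : Prop :=
  [/\ forall i, submod_closed (comp i),
      forall x, exists2 y, y \in comp 0 & exists2 z, z \in comp 1 & x = y + z,
      forall x, x \in comp 0 -> x \in comp 1 -> x = 0
    & forall i j x y, x \in comp i -> y \in comp j ->
        tp_dot x y \in comp (i + j) /\ tp_bracket x y \in comp (i + j)].

Record graded_transposed_poisson := GradedTransposedPoisson {
  gr_algebra :> transposed_poisson K;
  gr_comp : 'Z_2 -> {pred gr_algebra};
  gr_gradingP : z2_grading gr_comp
}.

Definition homogeneous (A : graded_transposed_poisson) (d : 'Z_2)
    (f : {linear A -> A}) : Prop :=
  forall (i : 'Z_2) (x : A), x \in @gr_comp A i -> f x \in @gr_comp A (i + d).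
End RotaBaxter.

Section Extension.
Context (K : fieldType) (B : choiceType) (V : lmodType K).

Definition lin_ext (h : B -> V) (g : {malg K[B]}) : V :=
  \sum_(k <- msupp g) g@_k *: h k.

Lemma lin_extEw (h : B -> V) (g : {malg K[B]}) (d : {fset B}) :
  (msupp g `<=` d)%fset -> lin_ext h g = \sum_(k <- d) g@_k *: h k.
Proof.
move=> le; rewrite /lin_ext; apply: big_fset_incl => // k _ /mcoeff_outdom ->.
exact: scale0r.
Qed.

Lemma lin_ext_linear (h : B -> V) : linear (lin_ext h).
Proof.
move=> c x y; set d := (msupp x `|` msupp y `|` msupp (c *: x + y))%fset.
rewrite !(@lin_extEw h _ d);
  try by apply/fsubsetP => k; rewrite !in_fsetU => ->; rewrite ?orbT.
rewrite scaler_sumr -big_split; apply: eq_bigr => k _ /=.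
by rewrite mcoeffD mcoeffZ scalerDl scalerA.
Qed.

Lemma lin_extU (h : B -> V) k : lin_ext h << k >> = h k.
Proof.
rewrite (@lin_extEw h _ [fset k]%fset) ?big_seq_fset1 ?mcoeffUU ?scale1r //.
exact: msuppU_le.
Qed.

Lemma malg_linear_eq (f g : {malg K[B]} -> V) :
  linear f -> linear g -> (forall k, f << k >> = g << k >>) -> f =1 g.
Proof.
move=> lf lg e x.
pose F : {linear _ -> _} := HB.pack f (GRing.isLinear.Build _ _ _ _ f lf).
pose G : {linear _ -> _} := HB.pack g (GRing.isLinear.Build _ _ _ _ g lg).
rewrite -[f]/(F : _ -> _) -[g]/(G : _ -> _) (monalgE x) !linear_sum.
apply: eq_bigr => k _.
have -> : << x@_k *g k >> = x@_k *: << k >> :> {malg K[B]}.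
  by apply/malgP => j; rewrite mcoeffZ !mcoeffU; case: eqP; rewrite ?mulr1 ?mulr0.
by rewrite !linearZ /= e.
Qed.
End Extension.

Definition bilin_ext (K : fieldType) (B : choiceType) (V : lmodType K)
    (m : B -> B -> V) (x y : {malg K[B]}) : V :=
  lin_ext (fun i => lin_ext (m i) y) x.

Section BilinearExtension.
Context (K : fieldType) (B : choiceType) (V : lmodType K) (m : B -> B -> V).

Lemma bilin_ext_linearl y : linear (bilin_ext m ^~ y).
Proof. exact: lin_ext_linear. Qed.

Lemma bilin_ext_linearr x : linear (bilin_ext m x).
Proof.
move=> c y z; rewrite /bilin_ext /lin_ext scaler_sumr -big_split.
apply: eq_bigr => k _ /=.
rewrite -!/(lin_ext (m k) _) lin_ext_linear.
by rewrite scalerDr !scalerA mulrC.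
Qed.

Lemma bilin_extU i j : bilin_ext m << i >> << j >> = m i j.
Proof. by rewrite /bilin_ext !lin_extU. Qed.
End BilinearExtension.

Lemma bilin_eq (K : fieldType) (B : choiceType) (V : lmodType K)
    (F G : {malg K[B]} -> {malg K[B]} -> V) :
  (forall y, linear (F^~ y)) -> (forall x, linear (F x)) ->
  (forall y, linear (G^~ y)) -> (forall x, linear (G x)) ->
  (forall i j, F << i >> << j >> = G << i >> << j >>) ->
  forall x y, F x y = G x y.
Proof.
move=> Fl Fr Gl Gr e x y.
apply: (malg_linear_eq (Fl y) (Gl y)) => i.
exact: malg_linear_eq.
Qed.

Lemma trilin_eq (K : fieldType) (B : choiceType) (V : lmodType K)
    (F G : {malg K[B]} -> {malg K[B]} -> {malg K[B]} -> V) :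
  (forall y z, linear (fun x => F x y z)) ->
  (forall x z, linear (fun y => F x y z)) -> (forall x y, linear (F x y)) ->
  (forall y z, linear (fun x => G x y z)) ->
  (forall x z, linear (fun y => G x y z)) -> (forall x y, linear (G x y)) ->
  (forall i j k, F << i >> << j >> << k >> = G << i >> << j >> << k >>) ->
  forall x y z, F x y z = G x y z.
Proof.
move=> F1 F2 F3 G1 G2 G3 e x y z.
apply: (malg_linear_eq (F1 y z) (G1 y z)) => i.
exact: (bilin_eq (F := F << i >>) (G := G << i >>)).
Qed.

Section LinearCombinators.
Context (K : fieldType) (U V : lmodType K).

Lemma linear_add (f g : U -> V) :
  linear f -> linear g -> linear (fun x => f x + g x).
Proof. by move=> lf lg c x y; rewrite lf lg scalerDr addrACA. Qed.

Lemma linear_scale (f : U -> V) c x : linear f -> f (c *: x) = c *: f x.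
Proof.
move=> lf; have := lf c x 0; rewrite addr0 => ->.
suff -> : f 0 = 0 by rewrite addr0.
by have := lf (-1) 0 0; rewrite scaler0 addr0 scaleN1r addNr.
Qed.

Lemma linear_zero : linear (fun _ : U => 0 : V).
Proof. by move=> c x y; rewrite scaler0 addr0. Qed.
End LinearCombinators.

(* The algebra identities on basis vectors, checked for opaque products known
   only through their multiplication table, which keeps unification fast. *)
Section Table.
Context (K : numFieldType) (a : K) (A : lmodType K).
Context (dot bracket : A -> A -> A) (L I : int -> A).
Hypotheses (dotLL : forall n m, dot (L n) (L m) = L (n + m))
  (dotLI : forall n m, dot (L n) (I m) = I (n + m))
  (dotIL : forall n m, dot (I m) (L n) = I (n + m))
  (dotII : forall n m, dot (I n) (I m) = 0)
  (bracketLL : forall n m, bracket (L n) (L m) = (n - m)%:~R *: L (n + m))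
  (bracketLI : forall n m,
    bracket (L n) (I m) = - (m%:~R + a - n%:~R) *: I (n + m))
  (bracketIL : forall n m,
    bracket (I m) (L n) = (m%:~R + a - n%:~R) *: I (n + m))
  (bracketII : forall n m, bracket (I n) (I m) = 0)
  (dot_linearl : forall y, linear (dot^~ y))
  (dot_linearr : forall x, linear (dot x))
  (bracket_linearl : forall y, linear (bracket^~ y))
  (bracket_linearr : forall x, linear (bracket x)).

Lemma dotZl c x y : dot (c *: x) y = c *: dot x y.
Proof. exact: (linear_scale _ _ (dot_linearl y)). Qed.

Lemma dotZr c x y : dot x (c *: y) = c *: dot x y.
Proof. exact: (linear_scale _ _ (dot_linearr x)). Qed.

Lemma bracketZl c x y : bracket (c *: x) y = c *: bracket x y.
Proof. exact: (linear_scale _ _ (bracket_linearl y)). Qed.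

Lemma bracketZr c x y : bracket x (c *: y) = c *: bracket x y.
Proof. exact: (linear_scale _ _ (bracket_linearr x)). Qed.

Lemma dotDl y : {morph dot^~ y : u v / u + v}.
Proof. by move=> u v; have := dot_linearl y 1 u v; rewrite !scale1r. Qed.

Lemma dotDr x : {morph dot x : u v / u + v}.
Proof. by move=> u v; have := dot_linearr x 1 u v; rewrite !scale1r. Qed.

Lemma bracketDl y : {morph bracket^~ y : u v / u + v}.
Proof. by move=> u v; have := bracket_linearl y 1 u v; rewrite !scale1r. Qed.

Lemma bracketDr x : {morph bracket x : u v / u + v}.
Proof. by move=> u v; have := bracket_linearr x 1 u v; rewrite !scale1r. Qed.

Lemma dot0l y : dot 0 y = 0.
Proof. by have := dotZl 0 0 y; rewrite !scale0r. Qed.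

Lemma dot0r x : dot x 0 = 0.
Proof. by have := dotZr 0 x 0; rewrite !scale0r. Qed.

Lemma bracket0l y : bracket 0 y = 0.
Proof. by have := bracketZl 0 0 y; rewrite !scale0r. Qed.

Lemma bracket0r x : bracket x 0 = 0.
Proof. by have := bracketZr 0 x 0; rewrite !scale0r. Qed.

Let tableE := (dotLL, dotLI, dotIL, dotII,
  bracketLL, bracketLI, bracketIL, bracketII,
  dotZl, dotZr, bracketZl, bracketZr,
  dot0l, dot0r, bracket0l, bracket0r, scaler0, addr0, add0r).

Ltac move_index f e s :=
  let h := fresh in
  have h : e = s by [ring];
  pattern (f e);
  refine (@eq_ind_r _ (f s) _ _ (f e) (f_equal f h));
  cbv beta; clear h.

Ltac compare_at s :=
  rewrite /= ?tableE;
  repeat match goal with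
  | |- context [L ?e] => tryif constr_eq e s then fail else move_index L e s
  | |- context [I ?e] => tryif constr_eq e s then fail else move_index I e s
  end;
  try reflexivity;
  rewrite ?scalerA -?scalerDl ?rmorphB ?rmorphD /=;
  match goal with
  | |- ?c *: _ = 0 => rewrite (_ : c = 0) ?scale0r; [reflexivity | ring]
  | |- _ *: _ = _ *: _ => congr (_ *: _); ring
  end.

Let b (k : int + int) : A := match k with inl n => L n | inr m => I m end.

Lemma table_dotC i j : dot (b i) (b j) = dot (b j) (b i).
Proof. case: i j => n [] m; compare_at (n + m). Qed.

Lemma table_dotA i j k :
  dot (b i) (dot (b j) (b k)) = dot (dot (b i) (b j)) (b k).
Proof. case: i j k => n [] m [] k; compare_at (n + m + k). Qed.

Lemma table_bracketC i j : bracket (b i) (b j) + bracket (b j) (b i) = 0.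
Proof. case: i j => n [] m; compare_at (n + m). Qed.

Lemma table_jacobi i j k :
  bracket (b i) (bracket (b j) (b k)) + bracket (b j) (bracket (b k) (b i))
    + bracket (b k) (bracket (b i) (b j)) = 0.
Proof. case: i j k => n [] m [] k; compare_at (n + m + k). Qed.

Lemma table_leibniz i j k :
  dot (b k) (bracket (b i) (b j)) + dot (b k) (bracket (b i) (b j)) =
    bracket (dot (b k) (b i)) (b j) + bracket (b i) (dot (b k) (b j)).
Proof. case: i j k => n [] m [] k; compare_at (n + m + k). Qed.
End Table.

Section W.
Context (K : numFieldType) (a : K).

(* The free K-module on int + int: [inl n] indexes L_n, [inr m] indexes I_m. *)
Notation Wspace := {malg K[(int + int)%type]}.

Definition W_L (n : int) : Wspace := << inl n >>.
Definition W_I (m : int) : Wspace := << inr m >>.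

Definition W_dot_basis (x y : int + int) : Wspace :=
  match x, y with
  | inl n, inl m => W_L (n + m)
  | inl n, inr m => W_I (n + m)
  | inr m, inl n => W_I (n + m)
  | inr _, inr _ => 0
  end.

(* The value of [I_m, L_n] is the one forced by antisymmetry. *)
Definition W_bracket_basis (x y : int + int) : Wspace :=
  match x, y with
  | inl n, inl m => (n - m)%:~R *: W_L (n + m)
  | inl n, inr m => - (m%:~R + a - n%:~R) *: W_I (n + m)
  | inr m, inl n => (m%:~R + a - n%:~R) *: W_I (n + m)
  | inr _, inr _ => 0
  end.

Definition W_dot : Wspace -> Wspace -> Wspace := bilin_ext W_dot_basis.
Definition W_bracket : Wspace -> Wspace -> Wspace := bilin_ext W_bracket_basis.

(* Degree 0: span of the L_n.  Degree 1: span of the I_m. *)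
Definition W_deg (k : int + int) : 'Z_2 := if k is inl _ then 0 else 1.
Definition W_comp (i : 'Z_2) : {pred Wspace} :=
  [pred x : Wspace | all (fun k => W_deg k == i) (msupp x)].

Lemma W_dot_linearl y : linear (W_dot^~ y).
Proof. exact: bilin_ext_linearl. Qed.

Lemma W_dot_linearr x : linear (W_dot x).
Proof. exact: bilin_ext_linearr. Qed.

Lemma W_bracket_linearl y : linear (W_bracket^~ y).
Proof. exact: bilin_ext_linearl. Qed.

Lemma W_bracket_linearr x : linear (W_bracket x).
Proof. exact: bilin_ext_linearr. Qed.

Lemma W_dotLL n m : W_dot (W_L n) (W_L m) = W_L (n + m).
Proof. exact: bilin_extU. Qed.

Lemma W_dotLI n m : W_dot (W_L n) (W_I m) = W_I (n + m).
Proof. exact: bilin_extU. Qed.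

Lemma W_dotIL n m : W_dot (W_I m) (W_L n) = W_I (n + m).
Proof. exact: bilin_extU. Qed.

Lemma W_dotII n m : W_dot (W_I n) (W_I m) = 0.
Proof. exact: bilin_extU. Qed.

Lemma W_bracketLL n m : W_bracket (W_L n) (W_L m) = (n - m)%:~R *: W_L (n + m).
Proof. exact: bilin_extU. Qed.

Lemma W_bracketLI n m :
  W_bracket (W_L n) (W_I m) = - (m%:~R + a - n%:~R) *: W_I (n + m).
Proof. exact: bilin_extU. Qed.

Lemma W_bracketIL n m :
  W_bracket (W_I m) (W_L n) = (m%:~R + a - n%:~R) *: W_I (n + m).
Proof. exact: bilin_extU. Qed.

Lemma W_bracketII n m : W_bracket (W_I n) (W_I m) = 0.
Proof. exact: bilin_extU. Qed.

Lemma W_basis_case (k : int + int) :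
  << k >> = match k with inl n => W_L n | inr m => W_I m end :> Wspace.
Proof. by case: k. Qed.

Let linE := (dotZl W_dot_linearl, dotZr W_dot_linearr,
  bracketZl W_bracket_linearl, bracketZr W_bracket_linearr,
  dotDl W_dot_linearl, dotDr W_dot_linearr,
  bracketDl W_bracket_linearl, bracketDr W_bracket_linearr).

Ltac linear_tac :=
  solve [ move=> *;
    repeat match goal with
    | |- GRing.linear_for _ (fun _ => _ + _) => apply: linear_add
    end;
    solve [ match goal with
            | |- GRing.linear_for _ (fun _ => 0) => exact: linear_zero
            end
          | let c := fresh in let u := fresh in let v := fresh in
            move=> c u v; rewrite !linE; reflexivity ] ].

Lemma W_dotC : commutative W_dot.
Proof.
move=> x y; apply: (bilin_eq (F := W_dot) (G := fun x y => W_dot y x));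
  try by linear_tac.
move=> i j; rewrite !W_basis_case.
exact: (table_dotC W_dotLL W_dotLI W_dotIL W_dotII).
Qed.

Lemma W_dotA : associative W_dot.
Proof.
move=> x y z; apply: (trilin_eq (F := fun x y z => W_dot x (W_dot y z))
  (G := fun x y z => W_dot (W_dot x y) z)); try by linear_tac.
move=> i j k; rewrite !W_basis_case.
exact: (table_dotA W_dotLL W_dotLI W_dotIL W_dotII
  W_dot_linearl W_dot_linearr).
Qed.

Lemma W_bracketxx x : W_bracket x x = 0.
Proof.
have anti y z : W_bracket y z + W_bracket z y = 0.
  apply: (bilin_eq (F := fun y z => W_bracket y z + W_bracket z y)
    (G := fun _ _ => 0)); try by linear_tac.
  move=> i j; rewrite !W_basis_case.
  exact: (table_bracketC W_bracketLL W_bracketLI W_bracketIL W_bracketII).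
by move/eqP: (anti x x); rewrite -mulr2n -scaler_nat scaler_eq0 pnatr_eq0 /=
  => /eqP.
Qed.

Lemma W_jacobi x y z :
  W_bracket x (W_bracket y z) + W_bracket y (W_bracket z x)
    + W_bracket z (W_bracket x y) = 0.
Proof.
apply: (trilin_eq (F := fun x y z => W_bracket x (W_bracket y z)
  + W_bracket y (W_bracket z x) + W_bracket z (W_bracket x y))
  (G := fun _ _ _ => 0)); try by linear_tac.
move=> i j k; rewrite !W_basis_case.
exact: (table_jacobi W_bracketLL W_bracketLI W_bracketIL W_bracketII
  W_bracket_linearr).
Qed.

Lemma W_leibniz x y z :
  W_dot z (W_bracket x y) *+ 2 =
    W_bracket (W_dot z x) y + W_bracket x (W_dot z y).
Proof.
rewrite mulr2n.
apply: (trilin_eq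
  (F := fun x y z => W_dot z (W_bracket x y) + W_dot z (W_bracket x y))
  (G := fun x y z => W_bracket (W_dot z x) y + W_bracket x (W_dot z y)));
  try by linear_tac.
move=> i j k; rewrite !W_basis_case.
exact: (table_leibniz W_dotLL W_dotLI W_dotIL W_dotII
  W_bracketLL W_bracketLI W_bracketIL W_bracketII
  W_dot_linearr W_bracket_linearl W_bracket_linearr).
Qed.

Definition W_algebra : transposed_poisson K :=
  TransposedPoisson W_dot_linearl W_dot_linearr W_dotC W_dotA
    W_bracket_linearl W_bracket_linearr W_bracketxx W_jacobi W_leibniz.

Lemma W_compP (i : 'Z_2) (x : Wspace) :
  reflect (forall k, W_deg k != i -> x@_k = 0) (x \in W_comp i).
Proof.
apply: (iffP allP) => [h k ki|h k]; rewrite -?mcoeff_neq0.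
  by apply: contraNeq ki; rewrite mcoeff_neq0 => /h.
by apply: contraNT => /h ->.
Qed.

Lemma W_comp_submod i : submod_closed (W_comp i).
Proof.
split=> [|c x y /W_compP hx /W_compP hy]; apply/W_compP => k ki.
  by rewrite mcoeff0.
by rewrite mcoeffD mcoeffZ hx ?hy // mulr0 addr0.
Qed.

Lemma W_compZ i c x : x \in W_comp i -> c *: x \in W_comp i.
Proof.
case: (W_comp_submod i) => h0 h xi.
by rewrite -[c *: x]addr0; exact: (h c x 0 xi h0).
Qed.

Lemma W_comp_sum i (J : eqType) (r : seq J) (F : J -> Wspace) :
  {in r, forall j, F j \in W_comp i} -> \sum_(j <- r) F j \in W_comp i.
Proof.
case: (W_comp_submod i) => h0 h hF; rewrite big_seq.
apply: (big_ind (fun x => x \in W_comp i)) => // x y xi yi.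
by rewrite -[x]scale1r; exact: (h 1 x y xi yi).
Qed.

Lemma W_compU k i : W_deg k = i -> << k >> \in W_comp i.
Proof.
move=> <-; apply/W_compP => l kl; rewrite mcoeffU.
have [e|//] := eqVneq k l; by rewrite e eqxx in kl.
Qed.

Lemma bilin_ext_comp (m : int + int -> int + int -> Wspace) i j x y :
  (forall k l, m k l \in W_comp (W_deg k + W_deg l)) ->
  x \in W_comp i -> y \in W_comp j -> bilin_ext m x y \in W_comp (i + j).
Proof.
move=> hm /allP hx /allP hy; apply: W_comp_sum => k /hx /eqP <-.
by apply: W_compZ; apply: W_comp_sum => l /hy /eqP <-; apply: W_compZ.
Qed.

Lemma W_gradingP : z2_grading (A := W_algebra) W_comp.
Proof.
split.
- exact: W_comp_submod.
- move=> x; pose p i : Wspace :=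
    \sum_(k <- msupp (x : Wspace)) (if W_deg k == i then << (x : Wspace)@_k *g k >> else 0).
  have hp i : p i \in W_comp i.
    apply: W_comp_sum => k _; apply/W_compP => l li.
    case: eqP => ki; last by rewrite mcoeff0.
    rewrite mcoeffU; have [e|//] := eqVneq k l; by rewrite -e ki eqxx in li.
  exists (p 0); first exact: hp.
  exists (p 1); first exact: hp.
  rewrite [LHS](monalgE (x : Wspace)) -big_split; apply: eq_bigr => -[n|n] _ /=.
    by rewrite addr0.
  by rewrite add0r.
- move=> x /W_compP h0 /W_compP h1; apply/malgP => k; rewrite mcoeff0.
  by case: k => n; [rewrite h1 | rewrite h0].
- move=> i j x y xi yj.
  have h0 k := (W_comp_submod k).1.
  split; apply: bilin_ext_comp => //; move=> [n|n] [m|m] //=;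
    do ?[exact: h0 | apply: W_compZ]; apply: W_compU => //=; exact/val_inj.
Qed.

Definition W : graded_transposed_poisson K :=
  GradedTransposedPoisson W_gradingP.
End W.

(* Main.v *)
Require Import Defs.
From mathcomp Require Import all_boot all_order all_algebra.
From mathcomp.reals Require Import reals.
From mathcomp.real_closed Require Import complex.
From mathcomp.multinomials Require Import monalg.

Import GRing.Theory.
Local Open Scope ring_scope.

(** The theorem is a parity argument on the associative product.  For
    homogeneous [x], [y] of degrees [i], [j] and [f] of degree 1, consider
    [f x * f y = f (f x * y + x * f y) + lam f (x * y)]: the left side and the
    first term on the right apply [f] twice in total, hence have degree
    [i + j], whereas [f (x * y)] has degree [i + j + 1].  So
    [lam f (x * y) = 0] and, for [lam != 0], [f] kills every product
    ([odd_rota_baxter_dot]).  Since [L_0] is a unit ([W_dotL0]), every element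
    is a product. *)

Section OddRotaBaxter.
Context (K : fieldType) (A : graded_transposed_poisson K).

Lemma comp_disjoint (i : 'Z_2) (x : A) :
  x \in gr_comp i -> x \in gr_comp (i + 1) -> x = 0.
Proof.
have [_ _ disj _] := gr_gradingP A.
have [-> | ->] : i = 0 \/ i = 1.
  by case: i => -[|[|//]] ?; [left | right]; apply: val_inj.
  by rewrite add0r; exact: disj.
have -> : 1 + 1 = 0 :> 'Z_2 by apply: val_inj.
by move=> x1 x0; exact: disj.
Qed.

Lemma compD (i : 'Z_2) (x y : A) :
  x \in gr_comp i -> y \in gr_comp i -> x + y \in gr_comp i.
Proof.
have [/(_ i)[_ lin] _ _ _] := gr_gradingP A.
by move=> xi yi; have := lin 1 x y xi yi; rewrite scale1r.
Qed.

Lemma compB (i : 'Z_2) (x y : A) :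
  x \in gr_comp i -> y \in gr_comp i -> x - y \in gr_comp i.
Proof.
have [/(_ i)[_ lin] _ _ _] := gr_gradingP A.
by move=> xi yi; have := lin (-1) y x yi xi; rewrite scaleN1r addrC.
Qed.

Lemma comp_dot (i j : 'Z_2) (x y : A) :
  x \in gr_comp i -> y \in gr_comp j -> tp_dot x y \in gr_comp (i + j).
Proof. by have [_ _ _ mul] := gr_gradingP A => xi yj; case: (mul i j x y). Qed.

(** The weight term applies [f] once, and every other term of the
    Rota--Baxter identity applies it twice; so the weight term lies in both
    components and vanishes. *)
Lemma odd_rota_baxter_dot (lam : K) (f : {linear A -> A}) (i j : 'Z_2)
    (x y : A) :
  lam != 0 -> rota_baxter_for (@tp_dot K A) lam f -> homogeneous 1 f ->
  x \in gr_comp i -> y \in gr_comp j -> f (tp_dot x y) = 0.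
Proof.
move=> lam0 rb hom xi yj.
have two : 1 + 1 = 0 :> 'Z_2 by apply: val_inj.
have fxi := hom i x xi; have fyj := hom j y yj.
have odd_xy : f (tp_dot x y) \in gr_comp (i + j + 1).
  exact: hom (comp_dot _ _ _ _ xi yj).
have even_lhs : tp_dot (f x) (f y) \in gr_comp (i + j).
  by have := comp_dot _ _ _ _ fxi fyj; rewrite addrACA two addr0.
have even_rhs : f (tp_dot (f x) y + tp_dot x (f y)) \in gr_comp (i + j).
  rewrite -[i + j]addr0 -two addrA; apply: hom; apply: compD.
    by rewrite addrAC; exact: comp_dot.
  by rewrite -addrA; exact: comp_dot.
have even_weight : lam *: f (tp_dot x y) \in gr_comp (i + j).
  by have := compB _ _ _ even_lhs even_rhs; rewrite rb addrC addKr.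
have odd_weight : lam *: f (tp_dot x y) \in gr_comp (i + j + 1).
  have [/(_ (i + j + 1))[zero_in lin] _ _ _] := gr_gradingP A.
  by rewrite -[_ *: _]addr0; exact: lin.
have /eqP := comp_disjoint _ _ even_weight odd_weight.
by rewrite scaler_eq0 (negPf lam0) => /eqP.
Qed.

Lemma odd_rota_baxter_unit_eq0 (lam : K) (f : {linear A -> A}) (i : 'Z_2)
    (e : A) :
  lam != 0 -> rota_baxter_for (@tp_dot K A) lam f -> homogeneous 1 f ->
  e \in gr_comp i -> left_id e (@tp_dot K A) -> forall x, f x = 0.
Proof.
move=> lam0 rb hom ei unit_e x.
have [_ split_x _ _] := gr_gradingP A.
have [y y0 [z z1 ->]] := split_x x.
rewrite linearD -[y]unit_e -[z]unit_e.
rewrite (odd_rota_baxter_dot _ _ _ _ _ _ lam0 rb hom ei y0).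
by rewrite (odd_rota_baxter_dot _ _ _ _ _ _ lam0 rb hom ei z1) addr0.
Qed.

End OddRotaBaxter.

Lemma W_dotL0 (K : numFieldType) : left_id (W_L K 0) (@W_dot K).
Proof.
move=> x; apply: (malg_linear_eq (g := id) (W_dot_linearr _)) => // k.
rewrite !W_basis_case; case: k => n.
  by rewrite W_dotLL add0r.
by rewrite W_dotLI add0r.
Qed.

Theorem theorem4p9 (R : realType) (a : R[i]) (f : {linear W a -> W a}) :
  rota_baxter 1 f -> homogeneous 1 f -> forall x : W a, f x = 0.
Proof.
case=> rb_dot _ hom.
apply: (@odd_rota_baxter_unit_eq0 _ (W a) 1 f 0 (W_L _ 0)) => //.
- exact: oner_neq0.
- exact: W_compU.
- exact: W_dotL0.
Qed.
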